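(* Let $i\in\mathbb{V}$ be a vertex. If the height of $i$ is one, then the minimal polynomial of the preconditioned matrix $(\mathcal{P}^{\mathrm{hook}}_{\le i})^{-1}\mathcal{B}_{\le i}$ is given by $$\mu_{(\mathcal{P}^{\mathrm{hook}}_{\le i})^{-1}\mathcal{B}_{\le i}}(x)=(1-x)^2.$$
   Context: **Data.** Let $\mathbb{D}=(\mathbb{V},\mathbb{A})$ be a directed rooted tree (arborescence) with vertices $\mathbb{V}=\{1,\dots,N\}$ and arcs $\mathbb{A}=\{a_1,\dots,a_M\}$ directed away from the root $R$. Each vertex $i$ has a symmetric matrix $B_i\in\mathbb{R}^{n_i\times n_i}$; each arc $a_k=(i,j)$ has a symmetric $D_k\in\mathbb{R}^{\ell_k\times\ell_k}$ and coupling matrices $C_k^+\in\mathbb{R}^{\ell_k\times n_i}$, $C_k^-\in\mathbb{R}^{\ell_k\times n_j}$. A vertex is a leaf if it has no outgoing arcs, and an inner vertex otherwise. The height of a leaf is zero, and the height of an inner vertex is one plus the maximum height of its children. For $i\neq R$ let $\kappa(i)$ be the index of the unique arc entering $i$. For an inner vertex $i$ write its outgoing arcs as $a_{k_1}=(i,j_1),\dots,a_{k_r}=(i,j_r)$. **Nested matrices.** For a leaf $i$: $\mathcal{B}_{\le i}=B_i$, and $\mathcal{C}_i^-=C^-_{\kappa(i)}$ if $i\ne R$. For an inner vertex $i$: $\mathcal{D}_{\le i}=\mathrm{blkdiag}(D_{k_1},\dots,D_{k_r})$, $\mathcal{C}^+_{\le i}$ is the vertical stacking of $C^+_{k_1},\dots,C^+_{k_r}$,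 $\mathcal{C}^-_{\le i}=\mathrm{blkdiag}(\mathcal{C}^-_{j_1},\dots,\mathcal{C}^-_{j_r})$, and $$\mathcal{B}_{\le i}=\begin{pmatrix}\mathrm{blkdiag}(\mathcal{B}_{\le j_1},\dots,\mathcal{B}_{\le j_r}) & 0 & -(\mathcal{C}^-_{\le i})^T\\ 0 & B_i & (\mathcal{C}^+_{\le i})^T\\ -\mathcal{C}^-_{\le i} & \mathcal{C}^+_{\le i} & -\mathcal{D}_{\le i}\end{pmatrix};$$ for $i\neq R$, $\mathcal{C}_i^-=(0\ \cdots\ 0\ C^-_{\kappa(i)}\ 0)$, where $C^-_{\kappa(i)}$ occupies the columns of $\mathcal{B}_{\le i}$ containing the diagonal block $B_i$. For inner $i$, $$\mathcal{S}_{\le i}=\begin{pmatrix}-\mathcal{C}^-_{\le i}&\mathcal{C}^+_{\le i}\end{pmatrix}\mathrm{blkdiag}(\mathcal{B}_{\le j_1}^{-1},\dots,\mathcal{B}_{\le j_r}^{-1},B_i^{-1})\begin{pmatrix}-\mathcal{C}^-_{\le i}&\mathcal{C}^+_{\le i}\end{pmatrix}^T+\mathcal{D}_{\le i}.$$ **Standing assumptions.** All $B_i$ and all $\mathcal{B}_{\le i}$ are invertible, and all $\mathcal{S}_{\le i}$ ($i$ inner) are positive definite. Moreover, with $\mathcal{B}=\mathrm{blkdiag}(B_1,\dots,B_N)$, $\mathcal{D}=\mathrm{blkdiag}(D_1,\dots,D_M)$ and $\mathcal{C}$ the block matrix whose block row for $a_k=(i,j)$ has $C_k^+$ in block column $i$,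 $-C_k^-$ in block column $j$ and zeros elsewhere, the matrix $\mathcal{C}\mathcal{B}^{-1}\mathcal{C}^T+\mathcal{D}$ is positive definite. No specific assumptions are made on the coupling matrices $C_k^+$, $C_k^-$. **Hook preconditioner.** $\mathcal{P}^{\mathrm{hook}}_{\le i}=B_i$ for a leaf $i$, and for an inner vertex $i$ $$\mathcal{P}^{\mathrm{hook}}_{\le i}=\begin{pmatrix}\mathrm{blkdiag}(\mathcal{P}^{\mathrm{hook}}_{\le j_1},\dots,\mathcal{P}^{\mathrm{hook}}_{\le j_r}) & 0 & 0\\ 0 & B_i & 0\\ -\mathcal{C}^-_{\le i} & \mathcal{C}^+_{\le i} & -\mathcal{S}_{\le i}\end{pmatrix}.$$
   Formalization: Assumes in addition that some arc leaving i has a nonzero coupling matrix C_k^+ or C_k^-; if all of these vanish, the preconditioned matrix is the identity and its minimal polynomial is x-1, so the claim fails. *)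

(* Defs.v *)
From mathcomp Require Import all_boot all_order all_algebra.
From Stdlib Require Import FunctionalExtensionality.
Set Implicit Arguments.
Unset Strict Implicit.
Unset Printing Implicit Defensive.
Import Order.TTheory GRing.Theory Num.Theory.
Local Open Scope ring_scope.

Definition posdef (R : realFieldType) (n : nat) (A : 'M[R]_n) : Prop :=
  A^T = A /\ forall x : 'cV[R]_n, x != 0 -> 0 < (x^T *m A *m x) 0 0.

(* mxminpoly is only available in nonzero dimension; the zero ring of 0 x 0
   matrices is annihilated by the constant polynomial 1. *)
Definition minpoly (F : fieldType) (n : nat) : 'M[F]_n -> {poly F} :=
  if n is n'.+1 then fun A : 'M[F]_n'.+1 => mxminpoly A else fun=> 1.

(* \mxdiag only accepts square blocks; its definition is reused here. *)
Definition blkdiag (R : realFieldType) (r : nat) (p q : 'I_r -> nat)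
    (A : forall k, 'M[R]_(p k, q k)) : 'M[R]_(\sum_k p k, \sum_k q k) :=
  \mxblock_(k, l) (if k == l then conform_mx 0 (A k) else 0).

Fixpoint walk (N M : nat) (src tgt : 'I_M -> 'I_N)
    (i : 'I_N) (s : seq 'I_M) (j : 'I_N) : bool :=
  if s is k :: s' then (src k == i) && walk src tgt (tgt k) s' j else i == j.

Definition arborescence (N M : nat) (src tgt : 'I_M -> 'I_N) (root : 'I_N) :=
  forall i, exists! s : seq 'I_M, walk src tgt root s i.

Record treeSystem (R : realFieldType) (N M : nat) := TreeSystem {
  src : 'I_M -> 'I_N;
  tgt : 'I_M -> 'I_N;
  root : 'I_N;
  srctgt_arborescence : arborescence src tgt root;
  vdim : 'I_N -> nat;
  adim : 'I_M -> nat;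
  vmat : forall i, 'M[R]_(vdim i);
  vmat_sym : forall i, (vmat i)^T = vmat i;
  amat : forall k, 'M[R]_(adim k);
  amat_sym : forall k, (amat k)^T = amat k;
  cplus : forall k, 'M[R]_(adim k, vdim (src k));
  cminus : forall k, 'M[R]_(adim k, vdim (tgt k))
}.

(* The matrices attached to the subtree below a vertex with an n x n matrix
   B_i: the nested matrix B_{<=i}, the hook preconditioner, and the map that
   extends a matrix X with n columns to (0 .. 0 X 0), the columns of X being
   placed where B_{<=i} has its diagonal block B_i. The last one is applied to
   X = C^-_{kappa(i)}. *)
Record nested (R : realFieldType) (n : nat) := Nested {
  ndim : nat;
  nmat : 'M[R]_ndim;
  nhook : 'M[R]_ndim;
  npad : forall l, 'M[R]_(l, n) -> 'M[R]_(l, ndim)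
}.

Section Tree.
Variables (R : realFieldType) (N M : nat) (T : treeSystem R N M).
Implicit Types i j : 'I_N.

Definition out i : {set 'I_M} := [set k | src T k == i].
Definition leaf i : bool := out i == set0.

(* Heights and nested matrices are defined by recursion towards the leaves.
   Walks in an arborescence with N vertices have fewer than N arcs, so N rounds
   of a step from any starting point reach its fixpoint; see heightE, nestE. *)
Definition heightStep (h : 'I_N -> nat) i : nat :=
  if leaf i then 0%N else (\max_(k in out i) h (tgt T k)).+1.
Definition height : 'I_N -> nat := iter N heightStep (fun=> 0%N).

Definition leafNested i : nested R (vdim T i) :=
  Nested (vmat T i) (vmat T i) (fun _ X => X).

Section Inner.
Variable i : 'I_N.
Local Notation arc := (@enum_val _ (mem (out i))).
Variable ch : forall r : 'I_#|out i|, nested R (vdim T (tgt T (arc r))).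

Let chdim := (\sum_r ndim (ch r))%N.
Let outdim := (\sum_r adim T (arc r))%N.

Definition dDiag : 'M[R]_outdim := \mxdiag_r amat T (arc r).

(* conform_mx only transports along src T (arc r) = i. *)
Definition cPlusCol : 'M[R]_(outdim, vdim T i) :=
  \mxcol_r (conform_mx 0 (cplus T (arc r)) : 'M_(adim T (arc r), vdim T i)).

(* The arc entering the child tgt T (arc r) is arc r. *)
Definition cMinusDiag : 'M[R]_(outdim, chdim) :=
  blkdiag (fun r => npad (ch r) (cminus T (arc r))).

Definition cRow : 'M[R]_(outdim, chdim + vdim T i) :=
  row_mx (- cMinusDiag) cPlusCol.

Definition innerSchur : 'M[R]_outdim :=
  cRow *m block_mx (\mxdiag_r invmx (nmat (ch r))) 0 0 (invmx (vmat T i))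
       *m cRow^T + dDiag.

Definition innerNested : nested R (vdim T i) :=
  Nested
    (block_mx
      (block_mx (\mxdiag_r nmat (ch r)) 0 0 (vmat T i))
      (col_mx (- cMinusDiag^T) cPlusCol^T)
      (row_mx (- cMinusDiag) cPlusCol)
      (- dDiag))
    (block_mx
      (block_mx (\mxdiag_r nhook (ch r)) 0 0 (vmat T i))
      0
      (row_mx (- cMinusDiag) cPlusCol)
      (- innerSchur))
    (fun _ X => row_mx (row_mx 0 X) 0).

End Inner.

Definition nestStep (ch : forall j, nested R (vdim T j)) i :
    nested R (vdim T i) :=
  if leaf i then leafNested i
  else innerNested (fun r : 'I_#|out i| => ch (tgt T (enum_val r))).
Definition nest : forall i, nested R (vdim T i) := iter N nestStep leafNested.

Definition nestB i : 'M[R]_(ndim (nest i)) := nmat (nest i).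
Definition nestHook i : 'M[R]_(ndim (nest i)) := nhook (nest i).
Definition nestS i := innerSchur (fun r : 'I_#|out i| => nest (tgt T (enum_val r))).

Definition globalB : 'M[R]_(\sum_i vdim T i) := \mxdiag_i vmat T i.
Definition globalD : 'M[R]_(\sum_k adim T k) := \mxdiag_k amat T k.
Definition globalC : 'M[R]_(\sum_k adim T k, \sum_i vdim T i) :=
  \mxblock_(k, i) (if src T k == i then conform_mx 0 (cplus T k)
                   else if tgt T k == i then - conform_mx 0 (cminus T k)
                   else 0).

(* Without this, innerSchur and dDiag agree at a vertex of height one, the
   preconditioned matrix is the identity, and its minimal polynomial is
   'X - 1. *)
Definition coupled i : Prop :=
  exists2 k, src T k = i & cplus T k != 0 \/ cminus T k != 0.

Lemma walk_rcons i s k j :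
  walk (src T) (tgt T) i (rcons s k) j =
  walk (src T) (tgt T) i s (src T k) && (tgt T k == j).
Proof.
elim: s i => [|l s IHs] i /=; last by rewrite IHs andbA.
by rewrite eq_sym.
Qed.

Lemma walk_cat i s1 s2 j :
  walk (src T) (tgt T) i (s1 ++ s2) j ->
  exists2 m, walk (src T) (tgt T) i s1 m & walk (src T) (tgt T) m s2 j.
Proof.
elim: s1 i => [|l s1 IHs] i /=; first by exists i.
by case/andP=> -> /IHs.
Qed.

Lemma walk_size s i : walk (src T) (tgt T) (root T) s i -> (size s < N)%N.
Proof.
move=> ws.
have pre m : exists j, walk (src T) (tgt T) (root T) (take m s) j.
  by move: ws; rewrite -{1}(cat_take_drop m s) => /walk_cat[j wj _]; exists j.
pose v (m : 'I_(size s).+1) := xchoose (pre m).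
have v_inj : injective v.
  move=> m1 m2 eqv; apply: val_inj => /=.
  have [s0 [_ uniq_s0]] := srctgt_arborescence T (v m1).
  have e1 := uniq_s0 _ (xchooseP (pre m1)).
  have e2 : s0 = take m2 s by apply: uniq_s0; rewrite eqv; exact: xchooseP.
  have := congr1 size (etrans (esym e1) e2).
  by rewrite !size_takel // -ltnS.
by have := leq_card v v_inj; rewrite !card_ord.
Qed.

Lemma iter_tree (X : 'I_N -> Type) (f : (forall i, X i) -> forall i, X i) x0 :
  (forall x y i, (forall k, src T k = i -> x (tgt T k) = y (tgt T k)) ->
     f x i = f y i) ->
  iter N f x0 = f (iter N f x0).
Proof.
move=> fP; apply: functional_extensionality_dep => i; rewrite -iterS.
have [s [ws _]] := srctgt_arborescence T i.
suff iterP h1 h2 s' j : walk (src T) (tgt T) (root T) s' j ->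
    (N <= h1 + size s')%N -> (N <= h2 + size s')%N ->
    iter h1 f x0 j = iter h2 f x0 j.
  by apply: (iterP _ _ s) => //; rewrite ?addSn -?addnS leq_addr.
elim: h1 h2 s' j => [|h1 IH] [|h2] s' j w.
- by [].
- by rewrite add0n leqNgt (walk_size w).
- by move=> _; rewrite add0n leqNgt (walk_size w).
move=> le1 le2; rewrite !iterS; apply: fP => k srck.
by apply: (IH h2 (rcons s' k)); rewrite ?walk_rcons ?srck ?w ?eqxx //
  size_rcons addnS -addSn.
Qed.

Lemma heightE i :
  height i = if leaf i then 0%N else (\max_(k in out i) height (tgt T k)).+1.
Proof.
rewrite {1}/height (@iter_tree (fun=> nat)) // => x y j xy.
rewrite /heightStep; case: ifP => // _; congr _.+1.
by apply: eq_bigr => k; rewrite inE => /eqP/xy.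
Qed.

Lemma nestE i :
  nest i = if leaf i then leafNested i
           else innerNested (fun r : 'I_#|out i| => nest (tgt T (enum_val r))).
Proof.
rewrite {1}/nest iter_tree // => x y j xy; rewrite /nestStep; case: ifP => // _.
congr innerNested; apply: functional_extensionality_dep => r; apply: xy.
by have := enum_valP r; rewrite inE => /eqP.
Qed.

End Tree.

(* Main.v *)
Require Import Defs.
From mathcomp Require Import all_boot all_order all_algebra.
Import Order.TTheory GRing.Theory Num.Theory.
Local Open Scope ring_scope.

(** At a vertex of height one all children are leaves, where the hook
preconditioner is exact. Write A for the block diagonal of the vertex matrices
involved, G for the coupling row (cRow), D for the outgoing arc matrices and
S = G A^-1 G^T + D. The preconditioner is then P = [A 0; G -S] and the nested
matrix is B = [A G^T; G -D], and multiplying out shows that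

  B = P [1 A^-1 G^T; 0 1],

so P^-1 B is the identity plus a strictly upper triangular block
(hook_preconditioned). Such a matrix is annihilated by (X - 1)^2, and by no
proper divisor of it unless A^-1 G^T vanishes (minpoly_unipotent2). As A is
invertible, this happens only if G = 0, which is excluded by the nonzero
coupling block (cRow_coupled). *)

(** The minimal polynomial divides (X - 1)^2, hence is a power of X - 1; the
exponents 0 and 1 would each force A = 1. In dimension zero A = 1 always. *)
Lemma minpoly_unipotent2 (F : fieldType) (n : nat) (A : 'M[F]_n) :
  A != 1%:M -> (A - 1%:M) *m (A - 1%:M) = 0 -> minpoly A = (1 - 'X) ^+ 2.
Proof.
case: n A => [|n] A; first by rewrite [A]flatmx0 [1%:M]flatmx0 eqxx.
move=> A_neq1 A_unip; rewrite -sqrrN opprB -polyC1 /=.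
have hornerXsub1: horner_mx A ('X - 1%:P) = A - 1%:M.
  by rewrite rmorphB /= horner_mx_X horner_mx_C.
have: mxminpoly A %| ('X - 1%:P) ^+ 2.
  by apply: mxminpoly_min; rewrite rmorphXn /= hornerXsub1 expr2.
case/dvdp_exp_XsubCP=> k le_k2.
rewrite eqp_monic ?mxminpoly_monic ?monic_exp ?monicXsubC // => /eqP minE.
have [k2|k_neq2] := eqVneq k 2; first by rewrite minE k2.
have le_k1: (k <= 1)%N by rewrite -ltnS ltn_neqAle k_neq2.
(* For k < 2 the minimal polynomial divides X - 1, forcing A - 1 = 0. *)
have := mx_root_minpoly A; rewrite minE => root_k.
case/negP: A_neq1.
rewrite -subr_eq0 -hornerXsub1 -['X - _]expr1 -(subnK le_k1) exprD.
by rewrite rmorphM /= root_k mulr0.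
Qed.

Lemma minpoly_unitriangular (F : fieldType) (p q : nat) (X : 'M[F]_(p, q)) :
  X != 0 -> minpoly (block_mx 1%:M X 0 1%:M) = (1 - 'X) ^+ 2.
Proof.
move=> X_neq0; have sub1E:
    block_mx 1%:M X 0 1%:M - 1%:M = block_mx 0 X 0 0 :> 'M_(p + q).
  rewrite [X in _ - X](scalar_mx_block _ _ 1) opp_block_mx add_block_mx.
  by rewrite !subrr !subr0.
apply: minpoly_unipotent2; last first.
  by rewrite sub1E mulmx_block !mulmx0 !mul0mx !addr0 block_mx0.
rewrite -subr_eq0 sub1E -block_mx0; apply: contra X_neq0 => /eqP.
by case/eq_block_mx=> _ ->.
Qed.

(** Multiplying [A 0; G -S] by [1 W H; 0 1], where W = A^-1, produces the lower
right block G W H - S, which is -D by the choice of S: the preconditioner is the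
block LU factor of the nested matrix whose complement has unit diagonal. *)
Lemma hook_preconditioned (F : fieldType) (p q : nat) (A W : 'M[F]_p)
    (G : 'M[F]_(q, p)) (H : 'M[F]_(p, q)) (D S : 'M[F]_q) :
    A *m W = 1%:M -> S = G *m W *m H + D -> S \in unitmx ->
  invmx (block_mx A 0 G (- S)) *m block_mx A H G (- D) =
  block_mx 1%:M (W *m H) 0 1%:M.
Proof.
move=> AW defS S_unit; have [A_unit _] := mulmx1_unit AW.
have P_unit: block_mx A 0 G (- S) \in unitmx.
  rewrite unitmxE det_lblock unitrM -unitmxE A_unit -scaleN1r detZ.
  by rewrite unitrM unitrX ?unitrN1 // -unitmxE.
rewrite -[RHS](mulKmx P_unit) mulmx_block !mulmx1 !mulmx0 !addr0.
by rewrite !mulmxA AW mul1mx defS opprD !addrA subrr add0r.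
Qed.

Lemma posdef_unitmx (R : realFieldType) (n : nat) (A : 'M[R]_n) :
  posdef A -> A \in unitmx.
Proof.
case=> _ A_pos; rewrite -row_free_unit -kermx_eq0; apply/negPn/negP.
case/rowV0Pn=> v /sub_kermxP vA v_neq0.
have /A_pos: v^T != 0 by rewrite trmx_eq0.
by rewrite trmxK vA mul0mx mxE ltxx.
Qed.

Lemma mxdiag_mulV (F : fieldType) (r : nat) (p : 'I_r -> nat)
    (A : forall k, 'M[F]_(p k)) :
  (forall k, A k \in unitmx) ->
  (\mxdiag_k A k) *m (\mxdiag_k invmx (A k)) = 1%:M.
Proof.
move=> A_unit; rewrite {2}/mxdiag mul_mxdiag_mxblock -mxdiagZ /mxdiag.
apply: eq_mxblock => k l; case: eqP => [->|_]; last exact: mulmx0.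
by rewrite !conform_mx_id mulmxV.
Qed.

(** The default 0 of conform_mx is only taken when the dimensions differ. *)
Lemma conform_mx0_eq0 (R : nmodType) (m n n' : nat) (A : 'M[R]_(m, n)) :
  n = n' -> conform_mx (0 : 'M_(m, n')) A = 0 -> A = 0.
Proof. by move=> <-; rewrite conform_mx_id. Qed.

Section Inner.
Variables (R : realFieldType) (N M : nat) (T : treeSystem R N M) (i : 'I_N).
Variable ch :
  forall r : 'I_#|out T i|, nested R (vdim T (tgt T (enum_val r))).

(** A nonzero coupling block of an arc leaving i survives in the coupling row: C^+
is only transported along an equality of dimensions, and the first hypothesis,
which holds for the padding by zero columns, covers C^-. *)
Lemma cRow_coupled :
    (forall r, npad (ch r) (cminus T (enum_val r)) = 0 ->
       cminus T (enum_val r) = 0) ->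
  coupled T i -> cRow ch != 0.
Proof.
move=> pad_inj [k src_k nz_k]; apply/eqP.
have [r def_k]: exists r : 'I_#|out T i|, k = enum_val r.
  have k_out: k \in out T i by rewrite inE src_k.
  by exists (enum_rank_in k_out k); rewrite enum_rankK_in.
rewrite {k}def_k in src_k nz_k; rewrite /cRow -row_mx0 => /eq_row_mx[].
move/eqP; rewrite oppr_eq0 => /eqP Cm0 Cp0.
case: nz_k => /eqP[].
  have := congr1 (fun X => submxcol X r) Cp0.
  rewrite /cPlusCol mxcolK => Cp_r.
  apply: (@conform_mx0_eq0 _ _ _ (vdim T i)); first by rewrite src_k.
  by rewrite Cp_r; apply/matrixP=> x y; rewrite !mxE.
have := congr1 (fun X => submxblock X r r) Cm0.
rewrite /cMinusDiag /blkdiag mxblockK eqxx conform_mx_id => Cm_r.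
by apply: pad_inj; rewrite Cm_r; apply/matrixP=> x y; rewrite !mxE.
Qed.

(** The first hypothesis expresses that the hook preconditioner is exact at the
children, as it is at leaves; the preconditioner and the nested matrix at i then
share their upper left block. *)
Lemma minpoly_inner_hook :
    (forall r, nhook (ch r) = nmat (ch r)) ->
    (forall r, nmat (ch r) \in unitmx) -> vmat T i \in unitmx ->
    innerSchur ch \in unitmx -> cRow ch != 0 ->
  minpoly (invmx (nhook (innerNested ch)) *m nmat (innerNested ch)) =
  (1 - 'X) ^+ 2.
Proof.
move=> hookE ch_unit v_unit S_unit row_neq0 /=.
have -> : \mxdiag_r nhook (ch r) = \mxdiag_r nmat (ch r).
  by apply: eq_mxdiag.
set A := block_mx (\mxdiag_r _) 0 0 _.
pose W := block_mx (\mxdiag_r invmx (nmat (ch r))) 0 0 (invmx (vmat T i)).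
have AW: A *m W = 1%:M.
  rewrite mulmx_block !mulmx0 !mul0mx !addr0 add0r mxdiag_mulV // mulmxV //.
  by rewrite -!scalar_mx_block.
have -> : col_mx (- (cMinusDiag ch)^T) (cPlusCol T i)^T = (cRow ch)^T.
  by rewrite tr_row_mx linearN.
rewrite (hook_preconditioned _ _ _ _ W) // -/(cRow ch) //.
apply: minpoly_unitriangular; apply: contra row_neq0 => /eqP WG0.
by rewrite -trmx_eq0 -[_^T]mul1mx -AW -mulmxA WG0 mulmx0.
Qed.

End Inner.

Theorem lemma3p1 (R : realFieldType) (N M : nat) (T : treeSystem R N M)
  (vmat_unit : forall i, vmat T i \in unitmx)
  (nestB_unit : forall i, nestB T i \in unitmx)
  (nestS_posdef : forall i, ~~ leaf T i -> posdef (nestS T i))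
  (schur_posdef :
     posdef (globalC T *m invmx (globalB T) *m (globalC T)^T + globalD T))
  (i : 'I_N) (height1 : height T i = 1%N) (coupled_i : coupled T i) :
  minpoly (invmx (nestHook T i) *m nestB T i) = (1 - 'X) ^+ 2.
Proof.
have leaf_i: leaf T i = false by move: height1; rewrite heightE; case: ifP.
have nest_child (r : 'I_#|out T i|):
    nest T (tgt T (enum_val r)) = leafNested T (tgt T (enum_val r)).
  rewrite nestE; case: ifP => // /negbT/negbTE inner_r.
  move: height1; rewrite heightE leaf_i => -[] /eqP.
  by rewrite -leqn0 => /bigmax_leqP/(_ _ (enum_valP r)); rewrite heightE inner_r.
rewrite /nestHook /nestB nestE leaf_i; apply: minpoly_inner_hook => //.
- by move=> r; rewrite nest_child.
- by apply: posdef_unitmx; apply: nestS_posdef; rewrite leaf_i.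
by apply: cRow_coupled => // r; rewrite nest_child.
Qed.
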